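(* Let $F_n$ be a free group of rank $n \ge 2$ and let $F(a,b)$ be the free group with basis $\{a,b\}$. Let $g, h \in F_n$ be translation equivalent in $F_n$ and let $w(a,b) \in F(a,b)$ be arbitrary. Then $w(g,h)$ and $w(h,g)$ are translation equivalent in $F_n$.
   Context: Fix a free basis $\Sigma$ of $F_n$. For $v \in F_n$, the cyclic length $\|v\|$ is the length (over $\Sigma$) of a cyclically reduced word conjugate to $v$, i.e. the length of the cyclic word associated with $v$. Two elements $g, h \in F_n$ are called translation equivalent in $F_n$ if $\|\phi(g)\| = \|\phi(h)\|$ for every automorphism $\phi$ of $F_n$. For $w(a,b) \in F(a,b)$ and $g,h \in F_n$, $w(g,h)$ denotes the image of $w$ under the homomorphism $F(a,b)\to F_n$ sending $a \mapsto g$, $b \mapsto h$. *)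

(* Defs.v *)
From mathcomp Require Import all_boot.
Set Implicit Arguments. Unset Strict Implicit. Unset Printing Implicit Defensive.

(* A letter is a generator index together with a flag: false = x_i, true = x_i^-1. *)
Definition letter (n : nat) : Type := ('I_n * bool)%type.

Definition inv_letter n (l : letter n) : letter n := (l.1, ~~ l.2).

Fixpoint reduced n (s : seq (letter n)) : bool :=
  match s with
  | x :: ((y :: _) as s') => (y != inv_letter x) && reduced s'
  | _ => true
  end.

Definition push n (x : letter n) (s : seq (letter n)) : seq (letter n) :=
  match s with
  | y :: s' => if y == inv_letter x then s' else x :: s
  | [::] => [:: x]
  end.

Definition reduce n (w : seq (letter n)) : seq (letter n) := foldr (@push n) [::] w.

Lemma reduced_behead n (s : seq (letter n)) : reduced s -> reduced (behead s).
Proof. by case: s => [|x [|y s]] //= /andP []. Qed.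

Lemma reduced_push n (x : letter n) s : reduced s -> reduced (push x s).
Proof.
case: s => [|y s] // Hs; rewrite /push.
case: ifP => Hy; first by have := reduced_behead Hs.
by rewrite -[reduced (x :: y :: s)]/((y != inv_letter x) && reduced (y :: s)) Hy Hs.
Qed.

Lemma reduce_reduced n (w : seq (letter n)) : reduced (reduce w).
Proof. by elim: w => [|x w IH] //=; apply: reduced_push. Qed.

Definition FG (n : nat) : Type := {w : seq (letter n) | reduced w}.

Definition fg_one n : FG n := exist _ [::] (erefl true).

Definition fg_mul n (u v : FG n) : FG n :=
  exist _ (reduce (proj1_sig u ++ proj1_sig v)) (reduce_reduced _).

Definition fg_inv n (u : FG n) : FG n :=
  exist _ (reduce (rev (map (@inv_letter n) (proj1_sig u)))) (reduce_reduced _).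

Definition is_aut n (phi : FG n -> FG n) : Prop :=
  (forall u v, phi (fg_mul u v) = fg_mul (phi u) (phi v)) /\ bijective phi.

(* cyclic reduction: repeatedly delete the first and last letters while they are
   mutually inverse (fuel k; k = length of the word suffices) *)
Fixpoint cyc_red n (k : nat) (s : seq (letter n)) : seq (letter n) :=
  match k with
  | 0 => s
  | k'.+1 =>
    match s with
    | x :: s' =>
        if (s' != [::]) && (last x s' == inv_letter x)
        then cyc_red k' (take (size s').-1 s')
        else s
    | [::] => s
    end
  end.

Definition cyclic_length n (v : FG n) : nat :=
  size (cyc_red (size (proj1_sig v)) (proj1_sig v)).

Definition translation_equivalent n (g h : FG n) : Prop :=
  forall phi : FG n -> FG n, is_aut phi -> cyclic_length (phi g) = cyclic_length (phi h).

(* w(g,h): image of w in F(a,b) = FG 2 (a = x_0, b = x_1) under a |-> g, b |-> h *)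
Definition subst2 n (w : FG 2) (g h : FG n) : FG n :=
  foldr (fun l acc =>
           let base := if nat_of_ord l.1 == 0 then g else h in
           fg_mul (if l.2 then fg_inv base else base) acc)
        (fg_one n) (proj1_sig w).

(* Main.v *)
(* Equality of the cyclic lengths of g and h alone already forces that of w(g,h)
   and w(h,g).  Let g and h act on the Cayley tree T of F_n, with translation
   length l > 0 and h different from g and g^-1.  The two axes are disjoint, or
   they meet in a segment, which is shorter than l since the action is free.  In
   either case the quotient by <g, h> of its minimal subtree, a barbell or a
   (possibly degenerate) theta graph, has an isometry exchanging g and h up to
   simultaneous conjugacy.  In terms of lengths: there are vertices p and q of T
   such that all words of length at most 2 in g^p, h^p have the same length as the
   corresponding words in h^q, g^q.  At such a p the cancellation in a reduced word
   in g^p, h^p is local, by the four-point property of trees, so these finitely many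
   lengths determine the length of every w(g^p, h^p).  Finally, the cyclic length of
   x is |x^2| - |x|. *)

Require Import Defs.
From mathcomp Require Import all_boot.
From HB Require Import structures.
From mathcomp Require Import zify.

Set Implicit Arguments. Unset Strict Implicit. Unset Printing Implicit Defensive.

Local Open Scope group_scope.

(** * Reduced words *)

Lemma inv_letterK n : involutive (@inv_letter n).
Proof. by case=> i e; rewrite /inv_letter /= negbK. Qed.

Lemma inv_letter_neq n (x : letter n) : x != inv_letter x.
Proof. by case: x => i []; rewrite /inv_letter /= xpair_eqE eqxx. Qed.

Definition no_cancel n : rel (letter n) := fun x y => y != inv_letter x.

Lemma reducedE n (s : seq (letter n)) : reduced s = sorted (@no_cancel n) s.
Proof. by elim: s => [|x [|y s] IH] //=; rewrite -/(reduced (y :: s)) IH. Qed.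

Lemma no_cancelC n (x y : letter n) :
  no_cancel (inv_letter y) (inv_letter x) = no_cancel x y.
Proof.
by rewrite /no_cancel inv_letterK eq_sym.
Qed.

Definition winv n (s : seq (letter n)) := rev (map (@inv_letter n) s).

Lemma winvK n : involutive (@winv n).
Proof.
by move=> s; rewrite /winv map_rev revK -map_comp map_id_in // => x _ /=; rewrite inv_letterK.
Qed.

Lemma winv_cat n (s t : seq (letter n)) : winv (s ++ t) = winv t ++ winv s.
Proof. by rewrite /winv map_cat rev_cat. Qed.

Lemma size_winv n (s : seq (letter n)) : size (winv s) = size s.
Proof. by rewrite size_rev size_map. Qed.

Lemma reduced_winv n (s : seq (letter n)) : reduced (winv s) = reduced s.
Proof.
rewrite !reducedE rev_sorted sorted_map; case: s => //= x s.
by apply: eq_path => y z /=; rewrite no_cancelC.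
Qed.

Lemma reduced_catl n (s t : seq (letter n)) : reduced (s ++ t) -> reduced s.
Proof. by rewrite !reducedE => /cat_sorted2[]. Qed.

Lemma reduced_catr n (s t : seq (letter n)) : reduced (s ++ t) -> reduced t.
Proof. by rewrite !reducedE => /cat_sorted2[]. Qed.

Lemma reduced_glue n (s m t : seq (letter n)) :
  m != [::] -> reduced (s ++ m) -> reduced (m ++ t) -> reduced (s ++ m ++ t).
Proof.
case: m => [|x m] // _; rewrite !reducedE /= !sorted_cat_cons.
by case/andP=> -> _.
Qed.

Lemma reduced_junction n (s t : seq (letter n)) x y :
  reduced (rcons s x) -> reduced (y :: t) -> y != inv_letter x ->
  reduced (rcons s x ++ y :: t).
Proof.
move=> rs rt xy; rewrite cat_rcons -cat1s; apply: reduced_glue => //.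
  by rewrite cats1.
by move: rt; rewrite /= xy.
Qed.

(** Two reduced words can only cancel at their junction: [z] collects the letters removed there, by
    induction from the end of [s]. *)
Lemma cancel_decomp n (s t : seq (letter n)) : reduced s -> reduced t ->
  exists s' z t', [/\ s = s' ++ z, t = winv z ++ t' & reduced (s' ++ t')].
Proof.
elim/last_ind: s t => [|s x IH] t rs rt; first by exists [::], [::], t.
case: t rt => [|y t] rt; first by exists (rcons s x), [::], [::]; rewrite !cats0.
have [yx|yx] := eqVneq y (inv_letter x); last first.
  by exists (rcons s x), [::], (y :: t); rewrite cats0; split=> //; apply: reduced_junction.
rewrite -cats1 in rs *.
have [s' [z [t' [-> -> r]]]] := IH t (reduced_catl rs) (reduced_behead rt).
exists s', (z ++ [:: x]), t'; rewrite catA; split=> //.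
by rewrite winv_cat /= yx.
Qed.

Lemma reduce_id n (s : seq (letter n)) : reduced s -> reduce s = s.
Proof.
elim: s => [|x s IH] // r; rewrite /= IH; last exact: (reduced_behead r).
by case: s r {IH} => [|y s] //= /andP[/negbTE ->].
Qed.

Lemma push_invK n (x : letter n) s : reduced s -> push x (push (inv_letter x) s) = s.
Proof.
case: s => [|y s] r /=; first by rewrite eqxx.
rewrite inv_letterK; case: ifP => [/eqP yx|_] /=; last by rewrite eqxx.
by move: r; rewrite yx; case: s => [|z s] //= /andP[/negbTE ->].
Qed.

Lemma reduced_foldr_push n (s r : seq (letter n)) :
  reduced r -> reduced (foldr (@push n) r s).
Proof. by move=> rr; elim: s => //= x s; apply: reduced_push. Qed.

(** Pushing [x] after its inverse changes no reduced word, so words act on reduced words through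
    their reductions. Associativity of the product rests on this. *)
Lemma foldr_push_reduce n (s r : seq (letter n)) :
  reduced r -> foldr (@push n) r (reduce s) = foldr (@push n) r s.
Proof.
move=> rr; elim: s => //= x s <-; case: (reduce s) => [|y t] //=.
case: ifP => // /eqP ->; rewrite push_invK //.
exact: reduced_foldr_push.
Qed.

Lemma reduce_catl n (s t : seq (letter n)) : reduce (reduce s ++ t) = reduce (s ++ t).
Proof. by rewrite /reduce !foldr_cat foldr_push_reduce // reduce_reduced. Qed.

Lemma reduce_catr n (s t : seq (letter n)) : reduce (s ++ reduce t) = reduce (s ++ t).
Proof. by rewrite /reduce !foldr_cat -!/(reduce _) reduce_id // reduce_reduced. Qed.

Lemma reduce_winv n (s : seq (letter n)) : reduce (s ++ winv s) = [::].
Proof.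
elim/last_ind: s => // s x IH.
rewrite -cats1 winv_cat -catA (catA [:: x]) -reduce_catr -reduce_catl.
have -> : reduce (([:: x] ++ winv [:: x]) ++ winv s) = reduce (winv s).
  by rewrite -reduce_catl /= eqxx.
by rewrite reduce_catl reduce_catr.
Qed.

Lemma reduce_cancel n (s z t : seq (letter n)) :
  reduce ((s ++ z) ++ winv z ++ t) = reduce (s ++ t).
Proof.
by rewrite -catA (catA z) -reduce_catr -(reduce_catl (z ++ _)) reduce_winv reduce_catr.
Qed.

(** * The free group and its word length *)

HB.instance Definition _ n := Choice.copy (FG n) {w : seq (letter n) | reduced w}.

Lemma fg_mulA n : associative (@fg_mul n).
Proof. by move=> x y z; apply: val_inj; rewrite /= reduce_catr reduce_catl catA. Qed.

Lemma fg_mul1 n : right_id (fg_one n) (@fg_mul n).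
Proof. by move=> x; apply: val_inj; rewrite /= cats0 reduce_id // (valP x). Qed.

Lemma fg_1mul n : left_id (fg_one n) (@fg_mul n).
Proof. by move=> x; apply: val_inj; rewrite /= reduce_id // (valP x). Qed.

Lemma fg_mulV n : right_inverse (fg_one n) (@fg_inv n) (@fg_mul n).
Proof. by move=> x; apply: val_inj; rewrite /= reduce_catr reduce_winv. Qed.

Lemma fg_Vmul n : left_inverse (fg_one n) (@fg_inv n) (@fg_mul n).
Proof.
move=> x; apply: val_inj; rewrite /= reduce_catl.
by rewrite -{2}[sval x]winvK reduce_winv.
Qed.

HB.instance Definition _ n := isGroup.Build (FG n)
  (@fg_mulA n) (@fg_1mul n) (@fg_mul1 n) (@fg_Vmul n) (@fg_mulV n).

Definition len n (x : FG n) := size (sval x).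

Lemma mul_decomp n (x y : FG n) : exists s z t,
  [/\ sval x = s ++ z, sval y = winv z ++ t & sval (x * y) = s ++ t].
Proof.
have [s [z [t [ex ey r]]]] := cancel_decomp (valP x) (valP y).
by exists s, z, t; split=> //=; rewrite ex ey reduce_cancel reduce_id.
Qed.

(* Lengths of products may differ in their inferred group structures, which are
   convertible but not recognized as equal by [lia]; hence the abstraction. *)
Ltac len_lia :=
  repeat match goal with
         | H : context [len _] |- _ => move: H
         | H : context [cyclic_length _] |- _ => move: H end;
  repeat match goal with |- context [@len ?n ?x] => move: (@len n x) => ? end;
  repeat match goal with
         | |- context [@cyclic_length ?n ?x] => move: (@cyclic_length n x) => ? end;
  lia.

Lemma len_eq0 n (x : FG n) : (len x == 0) = (x == 1).
Proof. by rewrite /len size_eq0. Qed.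

Lemma svalV n (x : FG n) : sval x^-1 = winv (sval x).
Proof. by rewrite /= reduce_id // -/(winv _) reduced_winv (valP x). Qed.

Lemma svalM n (x y : FG n) : sval (x * y) = reduce (sval x ++ sval y).
Proof. by []. Qed.

Lemma lenV n (x : FG n) : len x^-1 = len x.
Proof. by rewrite /len svalV size_winv. Qed.

Lemma len_mul_le n (x y : FG n) : len (x * y) <= len x + len y.
Proof.
rewrite /len; have [s [z [t [-> -> ->]]]] := mul_decomp x y.
rewrite !size_cat; lia.
Qed.

(* Of the three ways to pair up the vertices 1, x, xy, xyz of the Cayley tree,
   the two largest sums of distances agree. *)
Lemma four_point n (x y z : FG n) : len x + len z < len (x * y) + len (y * z) ->
  len (x * y * z) + len y = len (x * y) + len (y * z).
Proof.
have [s [a [y1 [ex ey exy]]]] := mul_decomp x y.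
have [y2 [b [t [ey' ez eyz]]]] := mul_decomp y z.
have szy : size (sval y) = size a + size y1 by rewrite ey size_cat size_winv.
have szy' : size (sval y) = size y2 + size b by rewrite ey' size_cat.
rewrite {1 2 3 4}/len exy eyz ex ez !size_cat size_winv => small.
(* By [small], the prefix [winv a] and the suffix [b] of [y] leave a nonempty middle, called [m]
   below, which keeps the two cancellations apart. *)
have y2E : y2 = winv a ++ drop (size a) y2.
  have : take (size (winv a)) (sval y) = winv a by rewrite ey take_size_cat.
  rewrite ey' take_cat size_winv; case: ltnP => [_ <-|]; last by lia.
  by rewrite -{1}[y2](cat_take_drop (size a)).
have m0 : drop (size a) y2 != [::].
  have : 0 < size (drop (size a) y2) by rewrite size_drop; lia.
  by case: (drop _ _).
move: (drop _ _) m0 y2E => m m0 y2E.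
have y1E : y1 = m ++ b.
  have : drop (size (winv a)) (sval y) = y1 by rewrite ey drop_size_cat.
  by rewrite ey' y2E -catA drop_size_cat.
have -> : len (x * y * z) = size (s ++ m ++ t).
  have rxy : reduced (sval (x * y)) := valP _.
  have ryz : reduced (sval (y * z)) := valP _.
  rewrite exy y1E catA in rxy; rewrite eyz y2E -catA in ryz.
  rewrite -mulgA /len svalM eyz ex y2E -[(winv a ++ m) ++ t]catA reduce_cancel reduce_id //.
  by apply: reduced_glue (reduced_catr ryz) => //; apply: reduced_catl rxy.
rewrite /len exy eyz ey' y1E y2E !size_cat size_winv; lia.
Qed.

Definition gen n (z : letter n) : FG n := exist _ [:: z] (erefl true).

Lemma len_gen n (z : letter n) : len (gen z) = 1%N.
Proof. by []. Qed.

Lemma len_gen_mul n (z : letter n) (x : FG n) :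
  len (gen z * x) = if ohead (sval x) == Some (inv_letter z) then (len x).-1 else (len x).+1.
Proof.
rewrite /len /= reduce_id ?(valP x) //.
by case: (sval x) => [|y s] //=; rewrite -[Some _ == _]/(y == _); case: ifP.
Qed.

Lemma len_gen_mul_lt n (z : letter n) (x : FG n) :
  (len (gen z * x) < len x) = (ohead (sval x) == Some (inv_letter z)).
Proof.
rewrite len_gen_mul; case: eqP => [|_]; last by lia.
by rewrite /len; case: (sval x) => //= *; lia.
Qed.

Lemma len_gen_mul_ge n (z : letter n) (x : FG n) :
  ~~ (len (gen z * x) < len x) -> len (gen z * x) = (len x).+1.
Proof. by rewrite len_gen_mul_lt len_gen_mul => /negbTE ->. Qed.

Lemma gen_uniq n (z z' : letter n) (x : FG n) :
  len (gen z * x) < len x -> len (gen z' * x) < len x -> z = z'.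
Proof.
rewrite !len_gen_mul_lt => /eqP -> /eqP [i e].
by rewrite -[z]inv_letterK -[z']inv_letterK /inv_letter /= i e.
Qed.

(** The witness is the last letter of [x], whose inverse is the first letter of [y]. *)
Lemma cancellation n (x y : FG n) : len (x * y) < len x + len y ->
  exists z, len (x * (gen z)^-1) < len x /\ len (gen z * y) < len y.
Proof.
have [s [c [t [ex ey exy]]]] := mul_decomp x y.
case/lastP: c ex ey => [|c z] ex ey.
  by rewrite /len exy ex ey cats0 size_cat ltnn.
move=> _; exists z; rewrite -(lenV x) -lenV invgM invgK !len_gen_mul_lt svalV ex ey.
by rewrite winv_cat -cats1 winv_cat /=.
Qed.

(** * Cyclic reduction and cyclic length *)

Lemma cyc_red_decomp n k (s : seq (letter n)) : reduced s -> size s <= k ->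
  exists c, [/\ s = c ++ cyc_red k s ++ winv c,
    reduced (cyc_red k s ++ cyc_red k s) & s != [::] -> cyc_red k s != [::]].
Proof.
elim: k s => [|k IH] [|x s] rs //= ks; try by exists [::].
case: ifP => [|ends].
  case/lastP: s ks rs => [//|s y] ks rs /andP[_]; rewrite last_rcons => /eqP yx.
  have rs' : reduced s.
    by move/reduced_behead: rs => /=; rewrite -cats1 => /reduced_catl.
  have s0 : s != [::].
    by apply: contraTneq rs => ->; rewrite yx /= eqxx.
  rewrite size_rcons -cats1 take_size_cat // in ks *.
  have [c [es r ne]] := IH s rs' (ltnW ks).
  exists (x :: c); split=> //; last by move=> _; apply: ne.
  by rewrite [in LHS]es /winv /= rev_cons -cats1 yx -!catA.
exists [::]; rewrite cats0; split=> //.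
case/lastP: s ends rs {ks} => [|s y].
  by move=> _ _; rewrite /= inv_letter_neq.
rewrite last_rcons -rcons_cons => ends rs; apply: reduced_junction => //.
move: ends; rewrite -size_eq0 size_rcons /= => /negbT.
by apply: contra => /eqP ->; rewrite inv_letterK.
Qed.

Lemma cyclic_decomp n (x : FG n) : exists c u,
  [/\ sval x = c ++ u ++ winv c, reduced (u ++ u), cyclic_length x = size u & x != 1 -> u != [::]].
Proof.
have [c [ex r ne]] := cyc_red_decomp (valP x) (leqnn _).
by exists c, (cyc_red (size (sval x)) (sval x)).
Qed.

(** Writing [x] as [c ++ u ++ winv c] with [u] cyclically reduced, the square is
    [c ++ u ++ u ++ winv c] without further cancellation. *)
Lemma len_square n (x : FG n) : len (x * x) = len x + cyclic_length x.
Proof.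
have [->|x1] := eqVneq x 1; first by [].
have [c [u [ex r -> u0]]] := cyclic_decomp x.
have {}u0 := u0 x1.
have rx := valP x; rewrite /= ex in rx.
have exx : sval (x * x) = c ++ u ++ u ++ winv c.
  have e1 : sval x = (c ++ u) ++ winv c by rewrite ex catA.
  have e2 : sval x = winv (winv c) ++ u ++ winv c by rewrite winvK.
  rewrite svalM {1}e1 e2.
  rewrite reduce_cancel reduce_id -?catA //.
  apply: reduced_glue => //; first by rewrite catA in rx; apply: reduced_catl rx.
  by apply: reduced_glue => //; apply: reduced_catr rx.
rewrite /len exx ex !size_cat; lia.
Qed.

Lemma cyclic_length_gt0 n (x : FG n) : x != 1 -> 0 < cyclic_length x.
Proof. by have [c [u [_ _ -> ne]]] := cyclic_decomp x => /ne; rewrite lt0n size_eq0. Qed.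

Lemma cyclic_length_le n (x : FG n) : cyclic_length x <= len x.
Proof. have := len_mul_le x x; rewrite len_square; lia. Qed.

Lemma cyclic_lengthV n (x : FG n) : cyclic_length x^-1 = cyclic_length x.
Proof. have := len_square x^-1; rewrite -invgM !lenV len_square => e; lia. Qed.

Lemma len_expSS n (x : FG n) k : x != 1 ->
  len (x ^+ k.+2) = len (x ^+ k.+1) + cyclic_length x.
Proof.
move=> /cyclic_length_gt0 x0; elim: k => [|k IH]; first by rewrite expg2 len_square expg1.
have := @four_point _ (x ^+ k.+1) x x; rewrite -!expgSr len_square; len_lia.
Qed.

Lemma len_exp n (x : FG n) k : x != 1 ->
  len (x ^+ k.+1) = len x + muln k (cyclic_length x).
Proof.
move=> x1; elim: k => [|k IH]; first by rewrite expg1 addn0.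
by rewrite len_expSS // IH mulSn; lia.
Qed.

Lemma len_conj_le n (x y : FG n) : len (x ^ y) <= len x + (len y).*2.
Proof.
have := len_mul_le y^-1 (x * y); have := len_mul_le x y; rewrite lenV /conjg; len_lia.
Qed.

(* The powers of x and of its conjugate differ in length by a bounded amount,
   while they grow at the respective rates [cyclic_length]. *)
Lemma cyclic_length_conj_le n (x y : FG n) : cyclic_length (x ^ y) <= cyclic_length x.
Proof.
have [->|x1] := eqVneq x 1; first by rewrite conj1g.
have xy1 : x ^ y != 1 by rewrite conjg_eq1.
rewrite leqNgt; apply/negP => lt.
(* If the cyclic length grew by at least one, the [k.+1]-st powers would differ by more than
   conjugation by [y] allows. *)
pose k := (len x + (len y).*2).+1.
have := len_conj_le (x ^+ k.+1) y; rewrite conjXg !len_exp //.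
have := leq_mul (leqnn k) lt; rewrite mulnS.
move: (muln _ _) (muln _ _) => u v; rewrite /k; len_lia.
Qed.

Lemma cyclic_lengthJ n (x y : FG n) : cyclic_length (x ^ y) = cyclic_length x.
Proof.
apply/eqP; rewrite eqn_leq cyclic_length_conj_le /=.
by rewrite -{1}(conjgK y x) cyclic_length_conj_le.
Qed.

Lemma cyclic_lengthC n (x y : FG n) : cyclic_length (y * x) = cyclic_length (x * y).
Proof. by rewrite -(cyclic_lengthJ (x * y) x) /conjg -mulgA mulKg. Qed.

(** * Conjugating a pair into good position *)

Lemma len_mul_cancel_le n (z : letter n) (x y : FG n) :
  len (x * y) <= len (x * (gen z)^-1) + len (gen z * y).
Proof.
have := len_mul_le (x * (gen z)^-1) (gen z * y).
by rewrite -mulgA mulKg.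
Qed.

Lemma conjg_invE n (x y : FG n) : x ^ y^-1 = y * x * y^-1.
Proof. by rewrite /conjg invgK mulgA. Qed.

Lemma conj_shorten n (z : letter n) (x : FG n) :
  len (gen z * x) < len x -> len (x * (gen z)^-1) < len x ->
  len (x ^ (gen z)^-1) < len x.
Proof.
(* The bound [xx] forces [len x] to be at least 2, so the two cancelling ends of [x] are different
   letters of the word. *)
move=> zx xz; have := len_mul_cancel_le z x x; rewrite len_square => xx.
have := @four_point _ (gen z)^-1 (gen z * x) (gen z)^-1.
rewrite !mulKg lenV len_gen conjg_invE; len_lia.
Qed.

Lemma cyclically_reduce n (x : FG n) : exists p, len (x ^ p) = cyclic_length x.
Proof.
have [m] := ubnP (len x); elim: m x => // m IH x xm.
have := cyclic_length_le x; rewrite leq_eqVlt => /orP[/eqP xr|lt].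
  by exists 1; rewrite conjg1 xr.
have [|z [xz zx]] := @cancellation _ x x; first by rewrite len_square; lia.
have [|p] := IH (x ^ (gen z)^-1); first by have := conj_shorten zx xz; len_lia.
by rewrite cyclic_lengthJ -conjgM => e; exists ((gen z)^-1 * p).
Qed.

(** Some [z] ends [g] while its inverse begins [h]. As [h] is not cyclically reduced, it also ends
    with [z]; conjugation then strips both ends of [h] but only rotates [g]. In the tree, the base
    vertex moves along the axis of [g] towards that of [h]. *)
Lemma barbell_step n (g h : FG n) : len g = cyclic_length g ->
  cyclic_length h < len h -> len (g * h) < len g + len h ->
  exists q, len (g ^ q) = len g /\ len (h ^ q) < len h.
Proof.
move=> gr hr /cancellation[z [gz zh]].
have [|z' [hz' zh']] := @cancellation _ h h; first by rewrite len_square; lia.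
rewrite (gen_uniq zh' zh) in hz'.
exists (gen z)^-1; split; last exact: conj_shorten.
have := cyclic_length_le (g ^ (gen z)^-1); rewrite cyclic_lengthJ -gr conjg_invE -mulgA.
have := len_mul_le (gen z) (g * (gen z)^-1); rewrite len_gen; len_lia.
Qed.

(** In the tree: no geodesic from 1 to [a] or [a^-1] shares its first edge with one from 1 to [b] or
    [b^-1]. *)
Definition uncancelled n (a b : FG n) :=
  [/\ len (a * b) = len a + len b, len (b * a) = len a + len b,
      len (a * b^-1) = len a + len b & len (a^-1 * b) = len a + len b].

(** Descent on [len h]: any cancellation in the four products lets [barbell_step] shorten [h], up to
    inverting [g] or [h]. For nontrivial elements it ends at a vertex on both axes, or where the
    bridge to a disjoint axis leaves the axis of [g]. *)
Lemma align_axes n (g h : FG n) : exists p, len (g ^ p) = cyclic_length g /\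
  (len (h ^ p) = cyclic_length h \/
   cyclic_length h < len (h ^ p) /\ uncancelled (g ^ p) (h ^ p)).
Proof.
have [p0 gp0] := cyclically_reduce g.
suff: forall g h : FG n, len g = cyclic_length g ->
    exists p, len (g ^ p) = cyclic_length g /\
    (len (h ^ p) = cyclic_length h \/
     cyclic_length h < len (h ^ p) /\ uncancelled (g ^ p) (h ^ p)).
  case/(_ (g ^ p0) (h ^ p0)); first by rewrite cyclic_lengthJ.
  by move=> p; rewrite !cyclic_lengthJ -!conjgM; exists (p0 * p).
move=> {p0 gp0} {}g {}h; have [m] := ubnP (len h); elim: m g h => // m IH g h hm gr.
have step q : len (g ^ q) = len g -> len (h ^ q) < len h ->
  exists p, len (g ^ p) = cyclic_length g /\
    (len (h ^ p) = cyclic_length h \/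
     cyclic_length h < len (h ^ p) /\ uncancelled (g ^ p) (h ^ p)).
  move=> gq hq; have [||p] := IH (g ^ q) (h ^ q); first by lia.
    by rewrite cyclic_lengthJ gq.
  by rewrite !cyclic_lengthJ -!conjgM; exists (q * p).
have := cyclic_length_le h; rewrite leq_eqVlt => /orP[/eqP hr|hr].
  by exists 1; rewrite !conjg1; split; [|left].
have [hg|hg] := ltnP (len (g * h)) (len g + len h).
  by have [q []] := barbell_step gr hr hg; apply: step.
have [hg1|hg1] := ltnP (len (h * g)) (len g + len h).
  have [||| q] := @barbell_step _ g^-1 h^-1; rewrite ?cyclic_lengthV -?invgM ?lenV //.
  by rewrite !conjVg !lenV => -[]; apply: step.
have [hg2|hg2] := ltnP (len (g * h^-1)) (len g + len h).
  have [||| q] := @barbell_step _ g h^-1; rewrite ?cyclic_lengthV ?lenV //.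
  by rewrite !conjVg !lenV => -[]; apply: step.
have [hg3|hg3] := ltnP (len (g^-1 * h)) (len g + len h).
  have [||| q] := @barbell_step _ g^-1 h; rewrite ?cyclic_lengthV ?lenV //.
  by rewrite !conjVg !lenV => -[]; apply: step.
exists 1; rewrite !conjg1; split=> //; right; split=> //.
have := len_mul_le g h; have := len_mul_le h g.
have := len_mul_le g h^-1; have := len_mul_le g^-1 h; rewrite !lenV.
by split; len_lia.
Qed.

(** The products cancel the common suffix [z] and the common prefix [winv p]. Together these cannot
    cover two distinct words of equal length. *)
Lemma common_affixes_lt n (x y : FG n) : len x = len y -> x != y ->
  len x + len y < len (x * y^-1) + len (x^-1 * y).
Proof.
have [s [z [t [ex ey exy]]]] := mul_decomp x y^-1.
have [s' [p [t' [ex' ey' exy']]]] := mul_decomp x^-1 y.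
have {}ey : sval y = winv t ++ z by rewrite -[y]invgK svalV ey winv_cat winvK.
have {}ex' : sval x = winv p ++ winv s' by rewrite -[x]invgK svalV ex' winv_cat.
move=> xy; apply: contraR; rewrite -leqNgt.
have sz : size s = size (winv t).
  by move: xy; rewrite /len ex ey !size_cat => /addIn.
have szx : size (sval x) = size p + size s' by rewrite ex' size_cat !size_winv.
have szy : size (sval y) = size p + size t' by rewrite ey' size_cat size_winv.
rewrite /len exy exy' !size_cat => big.
have sp : size s <= size (winv p).
  by rewrite size_winv; rewrite size_winv in sz; lia.
apply/eqP/val_inj; rewrite /= ex ey; congr (_ ++ _).
rewrite -[s](take_size_cat z (erefl _)) -[winv t](take_size_cat z (erefl _)).
by rewrite -ex -ey -sz ex' ey' !takel_cat.
Qed.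

(** If the last letter of [x] cancelled against both [y] and [y^-1], it would end [y] while its
    inverse begins [y], against cyclic reducedness. *)
Lemma cancel_one_side n (x y : FG n) : len y = cyclic_length y ->
  len (x * y) < len x + len y -> len (x * y^-1) = len x + len y.
Proof.
move=> yr /cancellation[z [xz zy]].
apply/eqP; rewrite eqn_leq -{1}(lenV y) len_mul_le /= leqNgt; apply/negP.
rewrite -{1}(lenV y) => /cancellation[z' [xz' zy']].
have zz : z' = z.
  by apply: (@gen_uniq _ _ _ x^-1); rewrite lenV -lenV invgM invgK.
rewrite {z' xz'}zz -lenV invgM invgK lenV in zy'.
have := len_mul_cancel_le z y y; rewrite len_square; len_lia.
Qed.

(** [four_point] gives the length of [a * b * a], then that of the square of [a * b]; the hypotheses
    amount to its premises. *)
Lemma cyclic_length_mul n (a b : FG n) :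
  (len a).*2 < len (a * b) + len (b * a) -> (len b).*2 < len (a * b) + len (b * a) ->
  cyclic_length (a * b) + len a + len b = len (a * b) + len (b * a).
Proof.
move=> ha hb.
have := @four_point _ a b a; have := @four_point _ (a * b) a b.
have := len_square (a * b); rewrite !mulgA; len_lia.
Qed.

(* While ab is not reduced, its last cancelling letter is moved from the end of a
   to its beginning. *)
Lemma slide_past_cancellation n (a b : FG n) : len a = cyclic_length a -> len b = cyclic_length b ->
  len a = len b -> a * b != 1 ->
  exists p, [/\ len (a ^ p) = len a, len (b ^ p) = len b &
    len (a ^ p * b ^ p) = len a + len b].
Proof.
have [m] := ubnP (len a + len b - len (a * b)); elim: m a b => // m IH a b hm ar br ab ab1.
have := len_mul_le a b; rewrite leq_eqVlt => /orP[/eqP e|lt].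
  by exists 1; rewrite !conjg1.
have [z [az zb]] := cancellation lt.
have az' : len (gen z * a) = (len a).+1.
  apply: len_gen_mul_ge; apply/negP => za.
  by have := len_mul_cancel_le z a a; rewrite len_square; len_lia.
have bz' : len (b * (gen z)^-1) = (len b).+1.
  rewrite -lenV invgM invgK -[len b]lenV; apply: len_gen_mul_ge; apply/negP.
  rewrite -[X in X < _]lenV invgM invgK lenV => bz.
  by have := len_mul_cancel_le z b b; rewrite len_square; len_lia.
have ab0 : 0 < len (a * b) by rewrite lt0n len_eq0.
pose q := (gen z)^-1.
have aq : len (a ^ q) = len a.
  have := cyclic_length_le (a ^ q); rewrite cyclic_lengthJ -ar conjg_invE -mulgA.
  by have := len_mul_le (gen z) (a * (gen z)^-1); rewrite len_gen; len_lia.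
have bq : len (b ^ q) = len b.
  have := cyclic_length_le (b ^ q); rewrite cyclic_lengthJ -br conjg_invE.
  by have := len_mul_le (gen z * b) (gen z)^-1; rewrite lenV len_gen; len_lia.
(* Neither end of [gen z * (a * b) * (gen z)^-1] cancels; [four_point] applies because [a * b] is
   nontrivial. *)
have abq : len (a ^ q * b ^ q) = (len (a * b)).+2.
  have := @four_point _ (gen z) a b.
  have := @four_point _ (gen z * a) b (gen z)^-1.
  rewrite -conjMg conjg_invE !mulgA lenV len_gen; len_lia.
have [|||||p] := IH (a ^ q) (b ^ q); rewrite ?aq ?bq ?cyclic_lengthJ //.
- by rewrite abq; lia.
- by rewrite -conjMg conjg_eq1.
by rewrite -!conjgM => -[]; exists (q * p).
Qed.

(** * Words in two elements *)

Definition letter_val n (a b : FG n) (l : letter 2) : FG n :=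
  let base := if nat_of_ord l.1 == 0 then a else b in if l.2 then base^-1 else base.

Definition word_val n (a b : FG n) (s : seq (letter 2)) : FG n :=
  foldr (fun l x => letter_val a b l * x) 1 s.

Lemma subst2E n (w : FG 2) (a b : FG n) : subst2 w a b = word_val a b (sval w).
Proof. by []. Qed.

Lemma letter_val_inv n (a b : FG n) l :
  letter_val a b (inv_letter l) = (letter_val a b l)^-1.
Proof. by case: l => i []; rewrite /letter_val /= ?invgK. Qed.

Lemma word_val_cat n (a b : FG n) s t :
  word_val a b (s ++ t) = word_val a b s * word_val a b t.
Proof. by elim: s => [|l s IH] /=; rewrite ?mul1g // IH mulgA. Qed.

Lemma word_val_reduce n (a b : FG n) s : word_val a b (reduce s) = word_val a b s.
Proof.
elim: s => //= l s <-; case: (reduce s) => [|k t] //=.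
by case: ifP => // /eqP ->; rewrite letter_val_inv mulVKg.
Qed.

Lemma word_val_conj n (a b p : FG n) s :
  word_val (a ^ p) (b ^ p) s = word_val a b s ^ p.
Proof.
elim: s => [|[i e] s IH] /=; first by rewrite conj1g.
by rewrite conjMg IH /letter_val /=; case: eqP; case: e; rewrite ?conjVg.
Qed.

(** This is the premise of [four_point] for consecutive letters: the cancellations on the two sides
    of [t] do not use up its value. *)
Definition nondegenerate n (a b : FG n) := forall s t r : letter 2,
  no_cancel s t -> no_cancel t r ->
  len (letter_val a b s) + len (letter_val a b r) <
  len (letter_val a b s * letter_val a b t) + len (letter_val a b t * letter_val a b r).

(* The cancellation in a reduced word in a and b is local: it only takes place
   between neighbouring letters. *)
Lemma len_word_val n (a b : FG n) s t w : nondegenerate a b -> reduced [:: s, t & w] ->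
  len (word_val a b [:: s, t & w]) + len (letter_val a b t) =
  len (letter_val a b s * letter_val a b t) + len (word_val a b (t :: w)).
Proof.
move=> nd; elim: w s t => [|r w IH] s t; first by rewrite /= !mulg1.
rewrite -[reduced _]/(no_cancel s t && reduced [:: t, r & w]) => /andP[st trw].
have tr : no_cancel t r by case/andP: trw.
(* By [IH], prepending [t] changes the length as it would before the single letter [r], so [nd]
   yields the premise of [four_point] for the whole tail. *)
have := IH t r trw; have := nd s t r st tr.
have := @four_point _ (letter_val a b s) (letter_val a b t) (word_val a b (r :: w)).
by rewrite -mulgA; rewrite /=; len_lia.
Qed.

Lemma letter2_ind (P : letter 2 -> Prop) :
  P (ord0, false) -> P (ord0, true) -> P (ord_max, false) -> P (ord_max, true) ->
  forall l, P l.
Proof.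
move=> P0 P1 P2 P3 [[[|[|//]] i] []].
- by rewrite (_ : Ordinal i = ord0) //; apply: val_inj.
- by rewrite (_ : Ordinal i = ord0) //; apply: val_inj.
- by rewrite (_ : Ordinal i = ord_max) //; apply: val_inj.
- by rewrite (_ : Ordinal i = ord_max) //; apply: val_inj.
Qed.

(** Up to inversion, these are all nonempty reduced words of length at most 2 in two letters. *)
Definition same_lengths n (a b c d : FG n) :=
  [/\ len a = len c, len b = len d, len (a * a) = len (c * c) & len (b * b) = len (d * d)] /\
  [/\ len (a * b) = len (c * d), len (b * a) = len (d * c),
      len (a * b^-1) = len (c * d^-1) & len (a^-1 * b) = len (c^-1 * d)].

Lemma len_mulVV n (a b : FG n) : len (a^-1 * b^-1) = len (b * a).
Proof. by rewrite -invgM lenV. Qed.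

Lemma len_mulV n (a b : FG n) : len (b * a^-1) = len (a * b^-1).
Proof. by rewrite -lenV invgM invgK. Qed.

Lemma len_Vmul n (a b : FG n) : len (b^-1 * a) = len (a^-1 * b).
Proof. by rewrite -lenV invgM invgK. Qed.

Lemma same_lengths_letter n (a b c d : FG n) s : same_lengths a b c d ->
  len (letter_val a b s) = len (letter_val c d s).
Proof. by case=> -[ac bd _ _] _; elim/letter2_ind: s; rewrite /letter_val /= ?lenV. Qed.

Lemma same_lengths_letters n (a b c d : FG n) s t : same_lengths a b c d -> no_cancel s t ->
  len (letter_val a b s * letter_val a b t) = len (letter_val c d s * letter_val c d t).
Proof.
case=> -[ac bd aa bb] [ab ba abV aVb].
elim/letter2_ind: s; elim/letter2_ind: t; rewrite /letter_val //= => _;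
  by rewrite ?len_mulVV // ?(len_mulV a) ?(len_mulV c) ?(len_Vmul a) ?(len_Vmul c).
Qed.

Lemma same_lengths_word n (a b c d : FG n) w : nondegenerate a b -> same_lengths a b c d ->
  len (word_val a b w) = len (word_val c d w).
Proof.
move=> nd same; rewrite -(word_val_reduce a) -(word_val_reduce c).
have nd' : nondegenerate c d.
  move=> s t r st tr; have := nd s t r st tr.
  by rewrite !(same_lengths_letter _ same) !(same_lengths_letters same).
have := reduce_reduced w; elim: (reduce w) => // s [_ _|t v IH rw].
  by rewrite /= !mulg1; apply: same_lengths_letter.
have := IH (reduced_behead rw); have := len_word_val nd rw; have := len_word_val nd' rw.
have st : no_cancel s t by case/andP: rw.
by rewrite (same_lengths_letter _ same) (same_lengths_letters same st); len_lia.
Qed.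

Lemma cyclic_length_transfer n (g h p q : FG n) w :
  nondegenerate (g ^ p) (h ^ p) -> same_lengths (g ^ p) (h ^ p) (h ^ q) (g ^ q) ->
  cyclic_length (word_val g h w) = cyclic_length (word_val h g w).
Proof.
move=> nd same.
rewrite -(cyclic_lengthJ _ p) -(cyclic_lengthJ (word_val h g w) q) -!word_val_conj.
have := len_square (word_val (g ^ p) (h ^ p) w).
have := len_square (word_val (h ^ q) (g ^ q) w).
rewrite -!word_val_cat !(same_lengths_word _ nd same); len_lia.
Qed.

(** Only equal letters cancel, and each loses less than half of its value because the cyclic lengths
    are positive. *)
Lemma uncancelled_nondegenerate n (a b : FG n) :
  a != 1 -> b != 1 -> uncancelled a b -> nondegenerate a b.
Proof.
move=> a1 b1 [ab ba abV aVb].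
have aa := len_square a; have := cyclic_length_gt0 a1.
have bb := len_square b; have := cyclic_length_gt0 b1.
move: a1 b1; rewrite -!len_eq0 => a0 b0 cb ca s t r.
elim/letter2_ind: s; elim/letter2_ind: t; elim/letter2_ind: r; rewrite /letter_val //= => _ _;
  rewrite ?len_mulVV ?(len_mulV a b) ?(len_Vmul a b) ?lenV; len_lia.
Qed.

Lemma cyclically_reduced_nondegenerate n (a b : FG n) :
  len a = cyclic_length a -> len b = cyclic_length b -> len a = len b ->
  a != 1 -> a != b -> a * b != 1 -> nondegenerate a b.
Proof.
move=> ar br eab a1 nab nabV.
have aa := len_square a; have := cyclic_length_gt0 a1.
have bb := len_square b.
(* [o1] and [o2] settle triples such as [a b^-1 a] and [a b a]. Every other triple has a junction
   without cancellation, inside a square or by [cancel_one_side]. *)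
have o1 := common_affixes_lt eab nab.
have o2 : len a + len b < len (a * b) + len (b * a).
  have := @common_affixes_lt _ a b^-1; rewrite lenV invgK len_mulVV; apply=> //.
  by rewrite -mulg_eq1.
have := @cancel_one_side _ a b br.
have := @cancel_one_side _ b a ar.
have := @cancel_one_side _ a^-1 b^-1; have := @cancel_one_side _ b^-1 a^-1.
rewrite !invgK !cyclic_lengthV !lenV !len_mulVV (len_mulV a b) (len_Vmul a b).
move=> /(_ ar) e1 /(_ br) e2 e3 e4.
have l1 := len_mul_le a b; have l2 := len_mul_le b a.
have l3 := len_mul_le a b^-1; have l4 := len_mul_le a^-1 b; rewrite !lenV in l3 l4.
move=> a0 s t r.
elim/letter2_ind: s; elim/letter2_ind: t; elim/letter2_ind: r; rewrite /letter_val //= => _ _;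
  rewrite ?len_mulVV ?(len_mulV a b) ?(len_Vmul a b) ?lenV; len_lia.
Qed.

(** * Exchanging the two elements *)

Lemma word_val_inverse n (g : FG n) w :
  commute (word_val g g^-1 w) g /\ word_val g^-1 g w = (word_val g g^-1 w)^-1.
Proof.
elim: w => [|l w [cw e]] /=.
  by rewrite invg1; split=> //; apply/commute_sym/commute1.
have cl : letter_val g g^-1 l = g \/ letter_val g g^-1 l = g^-1.
  by elim/letter2_ind: l; rewrite /letter_val /= ?invgK; auto.
have -> : letter_val g^-1 g l = (letter_val g g^-1 l)^-1.
  by elim/letter2_ind: l {cl}; rewrite /letter_val /= ?invgK.
case: cl => ->; split.
- by apply/commute_sym/commuteM; [|apply: commute_sym].
- by rewrite e -invgM cw.
- by apply/commute_sym/commuteM; [apply: commuteV|apply: commute_sym].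
- by rewrite e -invgM (commuteV cw).
Qed.

(** The left side is independent of [p], so the lengths at the two ends of a barbell can be
    compared. *)
Lemma cyclic_length_uncancelled n (g h p : FG n) :
  0 < cyclic_length g -> 0 < cyclic_length h -> uncancelled (g ^ p) (h ^ p) ->
  cyclic_length (g * h) = len (g ^ p) + len (h ^ p).
Proof.
move=> g0 h0 [u1 u2 _ _]; have := @cyclic_length_mul _ (g ^ p) (h ^ p).
have := cyclic_length_le (g ^ p); have := cyclic_length_le (h ^ p).
rewrite u1 u2 -conjMg !cyclic_lengthJ; len_lia.
Qed.

(** With no cancellation in [a * b], [cyclic_length_mul] determines [len (b * a)]; if [b * a]
    cancels, [cancel_one_side] rules out cancellation in the mixed products. *)
Lemma lengths_without_cancellation n (a b : FG n) :
  len a = cyclic_length a -> len b = cyclic_length b -> len a = len b ->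
  b * a != 1 -> len (a * b) = len a + len b ->
  len (b * a) = cyclic_length (a * b) /\
  (cyclic_length (a * b) < len a + len b ->
   len (a * b^-1) = len a + len b /\ len (a^-1 * b) = len a + len b).
Proof.
move=> ar br ab; rewrite -len_eq0 -lt0n => ba0 abl.
have ba : len (b * a) = cyclic_length (a * b).
  by have := @cyclic_length_mul _ a b; len_lia.
rewrite -ba; split=> // lt.
have := @cancel_one_side _ b a ar; have := @cancel_one_side _ a^-1 b^-1.
rewrite invgK cyclic_lengthV !lenV len_mulVV (len_mulV a b) => /(_ br); len_lia.
Qed.

Lemma cyclic_length_swap n (g h : FG n) w : cyclic_length g = cyclic_length h ->
  cyclic_length (word_val g h w) = cyclic_length (word_val h g w).
Proof.
move=> gh.
have [->//|ngh] := eqVneq g h.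
have [/eqP|nghV] := eqVneq (g * h) 1.
  rewrite mulg_eq1 -eqg_invLR => /eqP <-.
  by rewrite (word_val_inverse g w).2 cyclic_lengthV.
have g1 : g != 1.
  apply: contraNneq ngh => g1; rewrite eq_sym g1; apply: contraT => /cyclic_length_gt0.
  by rewrite -gh g1.
have h1 : h != 1.
  apply: contraNneq ngh => h1; rewrite h1; apply: contraT => /cyclic_length_gt0.
  by rewrite gh h1.
have g0 := cyclic_length_gt0 g1; have h0 := cyclic_length_gt0 h1.
have [p [gp hp]] := align_axes g h; have [q [hq gq]] := align_axes h g.
have [hr|[hlt unc]] := hp; last first.
  have ghp := cyclic_length_uncancelled g0 h0 unc.
  (* If both were cyclically reduced at [q], the cyclic length of [g * h] would be at most the sum
     of theirs, against [ghp] and [hlt]. *)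
  have [gr|[glt unc']] := gq.
    have := cyclic_length_le (h ^ q * g ^ q); have := len_mul_le (h ^ q) (g ^ q).
    by rewrite -conjMg cyclic_lengthJ cyclic_lengthC; len_lia.
  have hgq := cyclic_length_uncancelled h0 g0 unc'.
  rewrite cyclic_lengthC in hgq.
  apply: (@cyclic_length_transfer _ _ _ p q).
    by apply: uncancelled_nondegenerate; rewrite ?conjg_eq1.
  have [u1 u2 u3 u4] := unc; have [v1 v2 v3 v4] := unc'.
  by split; split; rewrite ?len_square ?cyclic_lengthJ ?u1 ?u2 ?u3 ?u4 ?v1 ?v2 ?v3 ?v4; len_lia.
have nd r : len (g ^ r) = cyclic_length g -> len (h ^ r) = cyclic_length h ->
    nondegenerate (g ^ r) (h ^ r).
  move=> gr hr'; apply: cyclically_reduced_nondegenerate;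
    rewrite -?conjMg ?cyclic_lengthJ ?conjg_eq1 ?(inj_eq (conjg_inj _)) //.
  by rewrite gr hr'.
have ghp1 : g ^ p * h ^ p != 1 by rewrite -conjMg conjg_eq1.
have nhgV : h * g != 1 by apply: contra nghV => /eqP/mulg1_eq <-; rewrite mulVg.
have hgp1 : h ^ p * g ^ p != 1 by rewrite -conjMg conjg_eq1.
(* The axes meet. Sliding leads to a vertex [P] where [g * h] does not cancel and a vertex [Q] where
   [h * g] does not; these are exchanged. *)
have [|||p1 [gp1 hp1 ghp]] := slide_past_cancellation (a := g ^ p) (b := h ^ p) _ _ _ ghp1;
  rewrite ?cyclic_lengthJ ?gp ?hr //.
have [|||q1 [hq1 gq1 hgq]] := slide_past_cancellation (a := h ^ p) (b := g ^ p) _ _ _ hgp1;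
  rewrite ?cyclic_lengthJ ?gp ?hr //.
rewrite -!conjgM gp hr in gp1 hp1 hq1 gq1 ghp hgq.
move: (p * p1) (p * q1) gp1 hp1 hq1 gq1 ghp hgq => P Q gP hP hQ gQ ghP hgQ.
have [|||||baP outP] := @lengths_without_cancellation _ (g ^ P) (h ^ P);
  rewrite -?conjMg ?cyclic_lengthJ ?conjg_eq1 ?gP ?hP // ?conjMg //.
have [|||||abQ outQ] := @lengths_without_cancellation _ (h ^ Q) (g ^ Q);
  rewrite -?conjMg ?cyclic_lengthJ ?conjg_eq1 ?gQ ?hQ // ?conjMg //.
rewrite -(conjMg g h) cyclic_lengthJ ?gP ?hP in baP outP.
rewrite -(conjMg h g) cyclic_lengthJ cyclic_lengthC ?gQ ?hQ in abQ outQ.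
have [lt|ge] := ltnP (cyclic_length (g * h)) (cyclic_length g + cyclic_length h).
  have [o1 o2] := outP lt; have [|o3 o4] := outQ; first by rewrite addnC.
  apply: (@cyclic_length_transfer _ _ _ P Q); first exact: nd.
  by split; split; rewrite ?len_square ?cyclic_lengthJ ?gP ?hP ?gQ ?hQ ?ghP ?baP ?hgQ ?abQ
    ?o1 ?o2 ?o3 ?o4 ?gh.
(* Here neither [g * h] nor [h * g] cancels at [P], and the mixed products are exchanged by
   inversion, so [P] serves for both pairs. *)
have ba_full : len (h ^ P * g ^ P) = cyclic_length g + cyclic_length h.
  have := len_mul_le (h ^ P) (g ^ P); len_lia.
apply: (@cyclic_length_transfer _ _ _ P P); first exact: nd.
split; split; rewrite ?len_square ?cyclic_lengthJ ?gP ?hP ?ghP ?ba_full ?gh //.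
- exact/esym/len_mulV.
- exact/esym/len_Vmul.
Qed.

Lemma is_aut_word_val n (phi : FG n -> FG n) (a b : FG n) w : is_aut phi ->
  phi (word_val a b w) = word_val (phi a) (phi b) w.
Proof.
case=> phi_mul _; have phiM : {morph phi : x y / x * y} := phi_mul.
have phi1 : phi 1 = 1 by apply: (@mulgI _ (phi 1)); rewrite -phiM !mulg1.
have phiV x : phi x^-1 = (phi x)^-1.
  by apply: (@mulgI _ (phi x)); rewrite mulgV -phiM mulgV.
elim: w => [|[i e] w IH] //=.
by rewrite phiM IH /letter_val /=; case: eqP; case: e; rewrite ?phiV.
Qed.

Theorem theorem1p4 (n : nat) (hn : 2 <= n) (g h : FG n) (w : FG 2) :
  translation_equivalent g h ->
  translation_equivalent (subst2 w g h) (subst2 w h g).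
Proof.
move=> gh phi aut; rewrite !subst2E !is_aut_word_val //.
exact/cyclic_length_swap/gh.
Qed.
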